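(* Let $2\le k<n$ be integers, let $G=([n],E,w)$ be a weighted graph with real edge weights, and let $F=[f_1,\dots,f_n]\in\mathbb{R}^{r\times n}$ be a feature matrix associated with $G$. Put $t=\sum_{i=1}^n f_i$. Let $(A_1,\dots,A_k)$ be a partition of $[n]$ and define $s_\ell=\sum_{i\in A_\ell}f_i$ for $\ell=1,\dots,k$. Then the value of the $k$-cut induced by $(A_1,\dots,A_k)$ is $$\operatorname{Cut}(A_1,\dots,A_k)=\frac12\left(\|t\|^2-\sum_{\ell=1}^k\|s_\ell\|^2\right).$$ Consequently, Max-$k$-Cut on $G$ is equivalent to minimizing $\Phi(A_1,\dots,A_k)=\sum_{\ell=1}^k\|s_\ell\|^2$ over all partitions $(A_1,\dots,A_k)$ of $[n]$; that is, a partition maximizes $\operatorname{Cut}$ if and only if it minimizes $\Phi$.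
   Context: $[n]=\{1,\dots,n\}$ and $\|\cdot\|$ is the Euclidean norm. A matrix $F=[f_1,\dots,f_n]\in\mathbb{R}^{r\times n}$ is a feature matrix associated with $G$ if its columns satisfy $w_{ij}=f_i^\top f_j$ for every $i\ne j$ (with $w_{ij}=0$ if $ij\notin E$). Partitions $(A_1,\dots,A_k)$ of $[n]$ consist of $k$ disjoint (possibly empty) parts with union $[n]$. Max-$k$-Cut on $G$ is the problem of maximizing $\operatorname{Cut}(A_1,\dots,A_k)=\sum_{\ell<m}\sum_{i\in A_\ell,\,j\in A_m}w_{ij}$ over all such partitions. *)

(* Defs.v *)
From mathcomp Require Import all_boot all_order all_algebra.
From mathcomp Require Import reals.

Set Implicit Arguments.
Unset Strict Implicit.
Unset Printing Implicit Defensive.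

Import Order.TTheory GRing.Theory Num.Theory.
Local Open Scope ring_scope.

(* The vertex set [n] = {1, ..., n} is encoded as 'I_n = {0, ..., n-1}. The
   weight is a total symmetric function, under the convention w_ij = 0 for
   ij not in E; edge weights are otherwise arbitrary reals. *)
Record wgraph (R : realType) (n : nat) := WGraph {
  edge : rel 'I_n;
  edge_sym : symmetric edge;
  edge_irr : irreflexive edge;
  weight : 'I_n -> 'I_n -> R;
  weight_sym : forall i j, weight i j = weight j i;
  weight_nonedge : forall i j, ~~ edge i j -> weight i j = 0
}.

(* MathComp-Analysis' norm on matrices is the sup norm, hence this one. *)
Definition enorm (R : realType) (r : nat) (x : 'cV[R]_r) : R :=
  Num.sqrt (\sum_(a < r) x a 0 ^+ 2).

(* The 1 x 1 product (col i F)^T *m col j F is read off at its only entry. *)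
Definition feature_matrix (R : realType) (n r : nat)
    (G : wgraph R n) (F : 'M[R]_(r, n)) : Prop :=
  forall i j : 'I_n, i != j -> weight G i j = ((col i F)^T *m col j F) 0 0.

(* Parts are indexed by 'I_k and may be empty, so [finset.partition], which
   excludes the empty block and forgets the indexing, does not apply. *)
Definition kpartition (n k : nat) (A : 'I_k -> {set 'I_n}) : Prop :=
  (forall l m : 'I_k, l != m -> [disjoint A l & A m]) /\
  \bigcup_(l < k) A l = [set: 'I_n].

Definition Cut (R : realType) (n k : nat) (G : wgraph R n)
    (A : 'I_k -> {set 'I_n}) : R :=
  \sum_(l < k) \sum_(m < k | (l < m)%N)
    \sum_(i in A l) \sum_(j in A m) weight G i j.

Definition Phi (R : realType) (n k r : nat) (F : 'M[R]_(r, n))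
    (A : 'I_k -> {set 'I_n}) : R :=
  \sum_(l < k) enorm (\sum_(i in A l) col i F) ^+ 2.

Definition maximizes (R : realType) (n k : nat)
    (f : ('I_k -> {set 'I_n}) -> R) (A : 'I_k -> {set 'I_n}) : Prop :=
  kpartition A /\ forall B : 'I_k -> {set 'I_n}, kpartition B -> f B <= f A.

Definition minimizes (R : realType) (n k : nat)
    (f : ('I_k -> {set 'I_n}) -> R) (A : 'I_k -> {set 'I_n}) : Prop :=
  kpartition A /\ forall B : 'I_k -> {set 'I_n}, kpartition B -> f A <= f B.

(* Main.v *)
(** Expanding [t = \sum_l s_l] gives [||t||^2 = \sum_l ||s_l||^2 + 2 \sum_(l < m) <s_l, s_m>],
    and the last sum is the cut, because distinct parts are disjoint and so only
    the off-diagonal entries of the Gram matrix of [F] occur in it. As [t] does not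
    depend on the partition, maximizing the cut is minimizing [\sum_l ||s_l||^2]. *)
Require Import Defs.
From mathcomp Require Import all_boot all_order all_algebra.
From mathcomp Require Import reals.
From mathcomp Require Import lra.

Import Order.TTheory GRing.Theory Num.Theory.
Local Open Scope ring_scope.

(** Each row splits into its diagonal entry and the entries on either side; transposing the part
    below the diagonal gives a second copy of the part above it. *)
Lemma sum_symmetric (V : nmodType) (k : nat) (g : 'I_k -> 'I_k -> V) :
  (forall l m, g l m = g m l) ->
  \sum_l \sum_m g l m =
    \sum_l g l l + (\sum_(l < k) \sum_(m < k | (l < m)%N) g l m) *+ 2.
Proof.
move=> g_sym.
have -> : \sum_l \sum_m g l m = \sum_l (g l l +
    (\sum_(m < k | (l < m)%N) g l m + \sum_(m < k | (m < l)%N) g l m)).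
  apply: eq_bigr => l _; rewrite (bigD1 l) //=; congr (_ + _).
  rewrite (bigID (fun m : 'I_k => (l < m)%N)) /=.
  by congr (_ + _); apply: eq_bigl => m; rewrite -val_eqE /=; case: ltngtP.
rewrite !big_split /= mulr2n; congr (_ + (_ + _)).
rewrite (exchange_big_dep predT) //=.
by apply: eq_bigr => l _; apply: eq_bigr => m _; apply: g_sym.
Qed.

Lemma sum_kpartition (V : nmodType) (n k : nat) (A : 'I_k -> {set 'I_n})
    (f : 'I_n -> V) :
  kpartition A -> \sum_i f i = \sum_(l < k) \sum_(i in A l) f i.
Proof.
case=> disjA covA; rewrite -partition_disjoint_bigcup // covA.
by apply: eq_bigl => i; rewrite in_setT.
Qed.

Lemma enorm_sqr (R : realType) (r : nat) (x : 'cV[R]_r) :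
  enorm x ^+ 2 = (x^T *m x) 0 0.
Proof.
rewrite sqr_sqrtr; last by apply: sumr_ge0 => a _; apply: sqr_ge0.
by rewrite mxE; apply: eq_bigr => a _; rewrite mxE expr2.
Qed.

Lemma dot_sym (R : realType) (r : nat) (x y : 'cV[R]_r) :
  (x^T *m y) 0 0 = (y^T *m x) 0 0.
Proof. by rewrite !mxE; apply: eq_bigr => a _; rewrite !mxE mulrC. Qed.

Lemma dot_sum (R : realType) (r : nat) (I J : finType) (P : pred I) (Q : pred J)
    (x : I -> 'cV[R]_r) (y : J -> 'cV[R]_r) :
  ((\sum_(i | P i) x i)^T *m (\sum_(j | Q j) y j)) 0 0 =
  \sum_(i | P i) \sum_(j | Q j) ((x i)^T *m y j) 0 0.
Proof.
rewrite (linear_sum trmx) mulmx_suml summxE; apply: eq_bigr => i _.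
by rewrite mulmx_sumr summxE.
Qed.

Lemma Cut_feature (R : realType) (n k r : nat) (G : wgraph R n)
    (F : 'M[R]_(r, n)) (A : 'I_k -> {set 'I_n}) :
  feature_matrix G F -> kpartition A ->
  Cut G A = 2^-1 * (enorm (\sum_(i < n) col i F) ^+ 2 - Phi F A).
Proof.
move=> hF hA.
set s := fun l => \sum_(i in A l) col i F.
have -> : Cut G A =
    \sum_(l < k) \sum_(m < k | (l < m)%N) ((s l)^T *m s m) 0 0.
  apply: eq_bigr => l _; apply: eq_bigr => m lt_lm.
  rewrite dot_sum; apply: eq_bigr => i Ai; apply: eq_bigr => j Aj.
  (* [hF] speaks only of distinct vertices: if [j] were [i], this vertex would lie in both [A l] and
     [A m]. *)
  apply: hF; apply: contraTneq Aj => <-.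
  have neq_lm : l != m by rewrite -val_eqE neq_ltn lt_lm.
  by rewrite (disjointFr (hA.1 l m neq_lm) Ai).
(* Grouping the total by parts turns its squared norm into the full sum of the Gram matrix of the
   [s l]. *)
rewrite (sum_kpartition _ _ _ _ _ hA) enorm_sqr dot_sum sum_symmetric; last first.
  by move=> l m; apply: dot_sym.
have -> : Phi F A = \sum_l ((s l)^T *m s l) 0 0.
  by apply: eq_bigr => l _; rewrite enorm_sqr.
by rewrite [X in X - _]addrC addrK -[X in _ * X]mulr_natl mulKf ?pnatr_eq0.
Qed.

Theorem mainTheorem4 (R : realType) (n k r : nat) (hk : (2 <= k)%N)
    (hkn : (k < n)%N) (G : wgraph R n) (F : 'M[R]_(r, n))
    (hF : feature_matrix G F) (A : 'I_k -> {set 'I_n}) (hA : kpartition A) :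
  let t : 'cV[R]_r := \sum_(i < n) col i F in
  let s (l : 'I_k) : 'cV[R]_r := \sum_(i in A l) col i F in
  Cut G A = 2^-1 * (enorm t ^+ 2 - \sum_(l < k) enorm (s l) ^+ 2) /\
  (maximizes (Cut G) A <-> minimizes (Phi F) A).
Proof.
move=> t s; split; first exact: Cut_feature.
(* The same [F] serves [A] and [B], so the norm of the total is a common constant and both
   directions are linear in [Phi F A] and [Phi F B]. *)
by split=> -[_ optA]; split=> // B hB; move: (optA B hB);
  rewrite !(Cut_feature _ _ _ _ _ _ _ hF) //; lra.
Qed.
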